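(* Let $(\Omega,\mathcal F)$ be a measurable space, let $\mathsf P$ be a probability measure on it, let $\mathcal P=\{\mathsf P\}$, and let $\mathcal Q\subseteq\mathcal M_1$ be nonempty and convex. Assume that $\inf_{\mathsf R\in\mathcal Q}H(\mathsf R\mid\mathsf P)<\infty$ and that there exists a random variable $X^*$ that is a $\mathsf P$-version of $d\mathsf Q^{\mathrm{GIPr}}/d\mathsf P$, where $\mathsf Q^{\mathrm{GIPr}}$ is the generalized I-projection of $\mathsf P$ onto $\mathcal Q$, such that $$\mathbb E_{\mathsf Q}[\log X^*]\ge\inf_{\mathsf R\in\mathcal Q}H(\mathsf R\mid\mathsf P)\qquad\text{for each }\mathsf Q\in\mathcal Q.$$ Then the e-variable $X^*$ achieves the supremum in $\mathsf G=\sup_{X\in\mathcal E}\inf_{\mathsf Q\in\mathcal Q}\mathbb E_{\mathsf Q}[\log X]$, and $$\mathsf G=\inf_{\mathsf Q\in\mathcal Q}\mathbb E_{\mathsf Q}[\log X^*]=\inf_{\mathsf Q\in\mathcal Q}H(\mathsf Q\mid\mathsf P).$$ Further, if the generalized I-projection is an I-projection (i.e., $\mathsf Q^{\mathrm{GIPr}}\in\mathcal Q$), then $X^*$ is the $\mathsf P$-a.s. unique GROW e-variable, i.e., the $\mathsf P$-a.s. unique $X\in\mathcal E$ with $\inf_{\mathsf Q\in\mathcal Q}\mathbb E_{\mathsf Q}[\log X]=\mathsf G$.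
   Context: $\mathcal M_1$ is the set of probability measures on $\mathcal F$. An e-variable for $\mathcal P=\{\mathsf P\}$ is a measurable $X:\Omega\to[0,\infty]$ with $\mathbb E_{\mathsf P}[X]\le1$; $\mathcal E$ is the set of all e-variables. Conventions: $\log0=-\infty$, $\log\infty=\infty$; $\mathbb E_{\mathsf Q}[\log X]=\mathbb E_{\mathsf Q}[(\log X)^+]-\mathbb E_{\mathsf Q}[(\log X)^-]$ if $\mathbb E_{\mathsf Q}[(\log X)^-]<\infty$, and $=-\infty$ if $\mathbb E_{\mathsf Q}[(\log X)^-]=\infty$. $H(\mathsf Q\mid\mathsf P)=\int\log(d\mathsf Q/d\mathsf P)\,d\mathsf Q$ if $\mathsf Q\ll\mathsf P$ and $=\infty$ otherwise. Generalized I-projection: for convex $\mathcal Q$ with $\inf_{\mathsf Q\in\mathcal Q}H(\mathsf Q\mid\mathsf P)<\infty$, $\mathsf Q^{\mathrm{GIPr}}$ is the unique probability measure (known to exist, not necessarily in $\mathcal Q$) satisfying $$H(\mathsf Q\mid\mathsf Q^{\mathrm{GIPr}})+\inf_{\mathsf R\in\mathcal Q}H(\mathsf R\mid\mathsf P)\le H(\mathsf Q\mid\mathsf P)\qquad\text{for all }\mathsf Q\in\mathcal Q.$$ It is known that $H(\mathsf Q^{\mathrm{GIPr}}\mid\mathsf P)\le\inf_{\mathsf Q\in\mathcal Q}H(\mathsf Q\mid\mathsf P)<\infty$, so $\mathsf Q^{\mathrm{GIPr}}\ll\mathsf P$. An I-projection of $\mathsf P$ onto $\mathcal Q$ is an element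 of $\mathcal Q$ achieving $\inf_{\mathsf Q\in\mathcal Q}H(\mathsf Q\mid\mathsf P)$. A ''$\mathsf P$-version'' of $d\mathsf Q^{\mathrm{GIPr}}/d\mathsf P$ is a $[0,\infty]$-valued measurable function that is $\mathsf P$-a.s. equal to this density. *)

(* Defs.v *)
From HB Require Import structures.
From mathcomp Require Import all_boot all_order all_algebra.
From mathcomp Require Import all_classical all_reals all_analysis.
From mathcomp Require Import measurable_realfun.
Set Implicit Arguments.
Unset Strict Implicit.
Unset Printing Implicit Defensive.
Import Order.TTheory GRing.Theory Num.Theory.
Import numFieldNormedType.Exports.
Local Open Scope classical_set_scope.
Local Open Scope ring_scope.
Local Open Scope charge_scope.
Local Open Scope ereal_scope.

(* The values of a library measure on non-measurable sets are arbitrary, so the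
   mixture is only pinned down on measurable sets. With t = 1 this makes Qs
   closed under equality of probability measures on the sigma-algebra. *)
Definition convex_probabilities (d : measure_display) (T : measurableType d)
    (R : realType) (Qs : set (probability T R)) : Prop :=
  forall (Q0 Q1 Q : probability T R) (t : R),
    Qs Q0 -> Qs Q1 -> (0 <= t <= 1)%R ->
    (forall A, measurable A -> Q A = t%:E * Q0 A + (1 - t)%:E * Q1 A) ->
    Qs Q.

Definition e_variable (d : measure_display) (T : measurableType d)
    (R : realType) (P : probability T R) (X : T -> \bar R) : Prop :=
  [/\ measurable_fun [set: T] X, forall x, 0 <= X x & \int[P]_x X x <= 1].

Definition expected_log (d : measure_display) (T : measurableType d)
    (R : realType) (Q : probability T R) (X : T -> \bar R) : \bar R :=
  let logX := fun x => lne (X x) in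
  if \int[Q]_x logX^\- x < +oo
  then \int[Q]_x logX^\+ x - \int[Q]_x logX^\- x
  else -oo.

(* +oo - +oo = -oo in the library, hence its integral follows the same
   convention. *)
Lemma expected_logE (d : measure_display) (T : measurableType d)
    (R : realType) (Q : probability T R) (X : T -> \bar R) :
  expected_log Q X = \int[Q]_x lne (X x).
Proof.
rewrite /expected_log [RHS]integralE; case: ifPn => //.
by rewrite -leNgt leye_eq => /eqP ->; rewrite addeNy.
Qed.

(* The derivative is only determined (and nonnegative) P-a.s., hence Q-a.s.
   when Q `<< P, so its version does not affect the integral. *)
Definition relative_entropy (d : measure_display) (T : measurableType d)
    (R : realType) (Q P : probability T R) : \bar R :=
  if `[< Q `<< P >]
  then \int[Q]_x lne (('d (charge_of_finite_measure Q) '/d P) x)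
  else +oo.

Definition inf_entropy (d : measure_display) (T : measurableType d)
    (R : realType) (P : probability T R) (Qs : set (probability T R)) : \bar R :=
  ereal_inf [set relative_entropy Q P | Q in Qs].

Definition is_generalized_I_projection (d : measure_display)
    (T : measurableType d) (R : realType) (P : probability T R)
    (Qs : set (probability T R)) (Qg : probability T R) : Prop :=
  forall Q, Qs Q ->
    relative_entropy Q Qg + inf_entropy P Qs <= relative_entropy Q P.

Definition is_density_version (d : measure_display) (T : measurableType d)
    (R : realType) (P Q : probability T R) (X : T -> \bar R) : Prop :=
  [/\ measurable_fun [set: T] X, forall x, 0 <= X x &
      {ae P, forall x, X x = ('d (charge_of_finite_measure Q) '/d P) x}].

Definition inf_expected_log (d : measure_display) (T : measurableType d)
    (R : realType) (Qs : set (probability T R)) (X : T -> \bar R) : \bar R :=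
  ereal_inf [set expected_log Q X | Q in Qs].

Definition grow_value (d : measure_display) (T : measurableType d)
    (R : realType) (P : probability T R) (Qs : set (probability T R)) : \bar R :=
  ereal_sup [set inf_expected_log Qs X | X in e_variable P].

Definition is_GROW (d : measure_display) (T : measurableType d)
    (R : realType) (P : probability T R) (Qs : set (probability T R))
    (X : T -> \bar R) : Prop :=
  e_variable P X /\ inf_expected_log Qs X = grow_value P Qs.

(* Main.v *)
Require Import Defs.
From mathcomp Require Import all_boot all_order all_algebra.
From mathcomp Require Import all_classical all_reals all_analysis.
From mathcomp Require Import measurable_realfun.
From mathcomp Require Import ring lra.
Import Order.TTheory GRing.Theory Num.Theory.
Import numFieldNormedType.Exports.
Local Open Scope classical_set_scope.
Local Open Scope charge_scope.
Local Open Scope ereal_scope.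

(** Everything rests on one inequality between e-variables and entropy: if [X]
is an e-variable for [P], then [E_Q[log X] <= H(Q|P)] for every [Q] (lemma
[gibbs]).  With [f] a density of [Q], the tangent line of the logarithm gives
[log X <= log f + X / f - 1], and [E_Q[X / f] <= E_P[X] <= 1].

Weak duality follows: the worst-case expected logarithm over [Qs] of any
e-variable is at most [inf_entropy P Qs].  The density [Xs] of [Qg] is an
e-variable, since it has [P]-integral 1, and by assumption it reaches this
bound, so it is optimal and all three values coincide.

For uniqueness, suppose that [Qg] lies in [Qs] and let [X] be optimal.  Then
[E_Qg[log X]] is at least the infimum of the entropies.  Once
[H(Qg|P) <= inf_entropy P Qs] is known, this is equality in the Gibbs
inequality for [Qg], and strict concavity of the logarithm forces [X = f]
where [f > 0].  There [X] already has the whole available mass 1, hence [X]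
vanishes elsewhere (lemma [gibbs_eq]).

The defining inequality of the generalized projection does not give
[H(Qg|P) <= inf_entropy P Qs] by direct substitution: it has to be passed to
the limit along a minimizing sequence (lemma [ln_density_le_inf_entropy]).  If
[Q] is a near minimizer, the projection inequality makes [H(Q|Qg)] small.  The
Gibbs inequality for the e-variable [1 + delta (E_Qg[l] - l)] of [Qg] then
bounds [E_Qg[l] - E_Q[l]] for each bounded [l] (lemma [bounded_test_near]; this
replaces Pinsker's inequality).  Taking [l = log u] with [u] an e-variable of
[P] bounded away from 0 and infinity, a second use of the Gibbs inequality
gives [E_Qg[log u] <= inf_entropy P Qs].  Truncations of the density provide
such [u], and Fatou's lemma removes the truncation. *)

(** * The tangent line of the logarithm *)

Lemma measurable_lne (R : realType) : measurable_fun [set: \bar R] (@lne R).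
Proof.
have -> : @lne R = fun x => if x <= 0 then -oo else
    if x == +oo then +oo else (ln (fine x))%:E.
  by apply/funext => -[r| |] //=; rewrite ?lee_fin ?leNye.
apply: measurable_fun_ifT => //.
  apply: (measurable_fun_bool true); rewrite setTI.
  have -> : (fun x : \bar R => x <= 0) @^-1` [set true] = `]-oo, 0] by [].
  exact: emeasurable_itv.
apply: measurable_fun_ifT => //.
  apply: (measurable_fun_bool true); rewrite setTI.
  rewrite [X in measurable X](_ : _ = [set +oo])//.
  by apply/seteqP; split => x /= /eqP.
by apply/measurable_EFinP; apply: measurableT_comp.
Qed.

Section log_tangent.
Set Implicit Arguments.
Unset Strict Implicit.
Variable R : realType.
Implicit Types (f a b u : R) (X : \bar R).

Lemma ln_le_sub1 f : (0 < f)%R -> (ln f <= f - 1)%R.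
Proof.
move=> f0; rewrite -[in leLHS](subrKC 1 f) (addrC f).
by rewrite addrC le_ln1Dx// ltrBrDl addrN.
Qed.

(** Writing [f = s ^+ 2], the bound [ln s <= s - 1] improves [ln f <= f - 1] by
[(s - 1) ^+ 2], so equality forces [s = 1]. *)
Lemma ln_eq_sub1 f : (0 < f)%R -> (ln f = f - 1)%R -> f = 1%R.
Proof.
move=> f0 lnf.
have s0 : (0 < Num.sqrt f)%R by rewrite sqrtr_gt0.
have fs : f = (Num.sqrt f ^+ 2)%R by rewrite sqr_sqrtr// ltW.
move: (Num.sqrt f) s0 fs lnf (ln_le_sub1 s0) => s s0 -> {f0}.
rewrite lnXn// mulr2n => ln2 lns.
have /eqP : ((s - 1) ^+ 2 = 0)%R by apply/eqP; rewrite eq_le sqr_ge0 andbT; nra.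
by rewrite sqrf_eq0 subr_eq0 => /eqP ->; rewrite expr1n.
Qed.

Lemma lne_le_tangent f X : (0 < f)%R -> 0 <= X ->
  lne X <= (ln f)%:E + (X * (f^-1)%:E - 1).
Proof.
move=> f0; case: X => [r| |]//.
  rewrite lee_fin le_eqVlt => /predU1P[<-|r0]; first by rewrite le0_lneNy// leNye.
  rewrite lne_EFin// -EFinM -EFinB -EFinD lee_fin.
  rewrite -lerBlDl -ln_div//; apply: ln_le_sub1; exact: divr_gt0.
by rewrite gt0_mulye ?lte_fin ?invr_gt0.
Qed.

(** The case [X = +oo] has to be excluded because both sides are then
infinite. *)
Lemma lne_eq_tangent f X : (0 < f)%R -> 0 <= X -> X < +oo ->
  lne X = (ln f)%:E + (X * (f^-1)%:E - 1) -> X = f%:E.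
Proof.
move=> f0; case: X => [r| |]//.
rewrite lee_fin le_eqVlt => /predU1P[<-|r0] _; first by rewrite le0_lneNy// mul0e.
rewrite lne_EFin// -EFinM -EFinB -EFinD => -[lnr].
have /ln_eq_sub1 rf : ln (r / f)%R = (r / f - 1)%R.
  by rewrite ln_div ?posrE// lnr addrAC subrr add0r.
by rewrite -(divfK (lt0r_neq0 f0) r) rf ?mul1r ?divr_gt0.
Qed.

(** This is the tangent bound at the inverse:
[ln (1 + u) >= 1 - (1 + u)^-1]. *)
Lemma ln_ge_quadratic u :
  (- 2^-1 <= u -> u - 2 * u ^+ 2 <= ln (1 + u))%R.
Proof.
move=> hu; have u1 : (0 < 1 + u)%R by lra.
have Vu1 : (0 < (1 + u)^-1)%R by rewrite invr_gt0.
have := ln_le_sub1 Vu1; rewrite lnV ?posrE// lerNl; apply: le_trans.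
rewrite -(ler_pM2r u1) opprB [leRHS]mulrBl mul1r mulVf ?gt_eqF//.
have : (0 <= u ^+ 2 * (1 + 2 * u))%R by rewrite mulr_ge0 ?sqr_ge0//; lra.
rewrite expr2; nra.
Qed.

Lemma normr_ln_le a b u : (0 < a)%R -> (a <= u <= b)%R ->
  (`|ln u| <= `|ln a| + `|ln b|)%R.
Proof.
move=> a0 /andP[au ub]; have u0 : (0 < u)%R := lt_le_trans a0 au.
have lau : (ln a <= ln u)%R by rewrite ler_ln ?posrE.
have lub : (ln u <= ln b)%R by rewrite ler_ln ?posrE// (lt_le_trans u0).
have := ler_norm (ln b); have := ler_norm (- ln a); rewrite normrN.
have := normr_ge0 (ln a); have := normr_ge0 (ln b).
by rewrite ler_norml => ? ? ? ?; apply/andP; split; lra.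
Qed.

End log_tangent.

(** * Comparison of integrals of extended real functions *)

Section integral_order.
Set Implicit Arguments.
Unset Strict Implicit.
Context (d : measure_display) (T : measurableType d) (R : realType).
Variable mu : measure T R.
Implicit Types f g : T -> \bar R.

(** Integrability is not assumed: the logarithm of an e-variable need not be
integrable.  Monotonicity holds for the positive and negative parts separately,
and the convention [+oo - +oo = -oo] is compatible with it. *)
Lemma le_integral_ae f g :
  measurable_fun [set: T] f -> measurable_fun [set: T] g ->
  {ae mu, forall x, f x <= g x} -> \int[mu]_x f x <= \int[mu]_x g x.
Proof.
move=> mf mg fg; rewrite integralE [leRHS]integralE; apply: leeB.
- apply: ae_ge0_le_integral => //; try exact: measurable_funepos.
  apply: filterS fg => x fgx _; rewrite !funeposE.
  by rewrite ge_max !le_max fgx lexx orbT.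
- apply: ae_ge0_le_integral => //; try exact: measurable_funeneg.
  apply: filterS fg => x fgx _; rewrite !funenegE.
  by rewrite ge_max !le_max leeN2 fgx lexx orbT.
Qed.

Lemma integrable_posneg f : measurable_fun [set: T] f ->
  \int[mu]_x f^\+ x < +oo -> \int[mu]_x f^\- x < +oo ->
  mu.-integrable [set: T] f.
Proof.
move=> mf fp fn; apply/integrableP; split=> //.
under eq_integral do rewrite -/((abse \o f) _) fune_abse.
rewrite ge0_integralD//.
- exact: lte_add_pinfty.
- exact: measurable_funepos.
- exact: measurable_funeneg.
Qed.

Lemma fin_num_integrable f : measurable_fun [set: T] f ->
  \int[mu]_x f x \is a fin_num -> mu.-integrable [set: T] f.
Proof.
move=> mf; rewrite integralE fin_numB => /andP[fp fn].
by apply: integrable_posneg => //; rewrite ltey_eq ?fp ?fn.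
Qed.

Lemma ge0_integrable f : measurable_fun [set: T] f ->
  (forall x, 0 <= f x) -> \int[mu]_x f x < +oo -> mu.-integrable [set: T] f.
Proof.
move=> mf f0 foo; apply/integrableP; split => //.
by under eq_integral do rewrite gee0_abs//.
Qed.

Lemma le_integral_ae_eq f g : measurable_fun [set: T] f ->
  mu.-integrable [set: T] g -> {ae mu, forall x, f x <= g x} ->
  \int[mu]_x g x <= \int[mu]_x f x ->
  {ae mu, forall x, f x = g x}.
Proof.
move=> mf ig fg gf.
have mg := measurable_int _ ig.
have Efg : \int[mu]_x f x = \int[mu]_x g x.
  by apply/eqP; rewrite eq_le gf le_integral_ae.
have intf : mu.-integrable [set: T] f.
  by apply: fin_num_integrable => //; rewrite Efg; exact: integrable_fin_num.
have mgf : measurable_fun [set: T] (g \- f) by exact: emeasurable_funB.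
have : ae_eq mu [set: T] (g \- f) (cst 0).
  apply/(ae_eq_integral_abs mu measurableT mgf).
  transitivity (\int[mu]_x (g x - f x)).
    apply: ae_eq_integral => //; first exact: measurableT_comp.
    apply: filterS2 fg (integrable_ae measurableT intf) => x fgx /(_ I) ffin _ /=.
    by rewrite gee0_abs// sube_ge0// ffin.
  by rewrite integralB// Efg subee//; exact: integrable_fin_num.
move=> fgz.
apply: filterS3 fgz (integrable_ae measurableT intf)
  (integrable_ae measurableT ig) => x /= /(_ I) + /(_ I) ffin /(_ I) gfin.
by move/eqP; rewrite sube_eq ?ffin ?fin_num_adde_defl// add0e => /eqP.
Qed.

End integral_order.

Lemma limn_einf_le (R : realType) (u : nat -> \bar R) (b : \bar R) :
  (forall n, u n <= b) -> limn_einf u <= b.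
Proof.
move=> ub; rewrite limn_einf_lim; apply: lime_le; first exact: is_cvg_einfs.
by apply: nearW => n; apply: le_trans (ub n); apply: ereal_inf_lbound; exists n => /=.
Qed.

(** * Densities *)

Section densities.
Set Implicit Arguments.
Unset Strict Implicit.
Context (d : measure_display) (T : measurableType d) (R : realType).
Implicit Types (P Q : probability T R) (f : T -> R) (X : T -> \bar R).

(** The density is a finite nonnegative function everywhere, unlike the
Radon-Nikodym derivative of a charge, and it is characterized by the change of
variables for nonnegative functions rather than by the values on sets only:
the arguments below integrate ratios whose integrability is not known in
advance. *)
Definition is_density P Q f : Prop :=
  [/\ measurable_fun [set: T] f, forall x, (0 <= f x)%R &
      forall h : T -> \bar R, measurable_fun [set: T] h -> (forall x, 0 <= h x) ->
        \int[Q]_x h x = \int[P]_x (h x * (f x)%:E)].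

Lemma density_exists P Q : Q `<< P -> exists2 f, is_density P Q f &
  {ae P, forall x, (f x)%:E = ('d (charge_of_finite_measure Q) '/d P) x}.
Proof.
move=> QP.
pose g := Radon_Nikodym_SigmaFinite.f Q P.
have fing x : g x \is a fin_num by exact: Radon_Nikodym_SigmaFinite.f_fin_num.
have gE x : (fine (g x))%:E = g x by rewrite fineK.
have mg : measurable_fun [set: T] g.
  exact: measurable_int (Radon_Nikodym_SigmaFinite.f_integrable QP).
exists (fine \o g).
  split => [|x|h mh h0].
  - exact: measurableT_comp.
  - by rewrite /= fine_ge0// Radon_Nikodym_SigmaFinite.f_ge0.
  - rewrite -(Radon_Nikodym_SigmaFinite.change_of_variables QP)//.
    by apply: eq_integral => x _; rewrite /= gE.
have := ae_eq_Radon_Nikodym_SigmaFinite QP measurableT.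
by apply: filterS => x /(_ I) <-; rewrite /= gE.
Qed.

Lemma density_set P Q f A : is_density P Q f -> measurable A ->
  Q A = \int[P]_x ((\1_A x)%:E * (f x)%:E).
Proof.
move=> [mf f0 fQ] mA; rewrite -fQ//.
- by rewrite integral_indic// setIT.
- exact/measurable_EFinP.
Qed.

Lemma density_null P Q f A : is_density P Q f -> measurable A -> Q A = 0 ->
  {ae P, forall x, A x -> f x = 0%R}.
Proof.
move=> fQ mA QA0; have [mf f0 _] := fQ.
have m1f : measurable_fun [set: T] (fun x => (\1_A x)%:E * (f x)%:E).
  by apply: emeasurable_funM; exact/measurable_EFinP.
have : ae_eq P [set: T] (fun x => (\1_A x)%:E * (f x)%:E) (cst 0).
  apply/(ae_eq_integral_abs P measurableT m1f).
  rewrite -QA0 (density_set fQ mA); apply: eq_integral => x _.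
  by rewrite gee0_abs// mule_ge0// lee_fin.
apply: filterS => x /(_ I) /= + Ax; rewrite indicE mem_set// mul1e.
by case.
Qed.

Lemma density_gt0 P Q f : is_density P Q f -> {ae Q, forall x, (0 < f x)%R}.
Proof.
move=> fQ; have [mf f0 _] := fQ.
have mA : measurable [set x | (f x)%:E <= 0].
  rewrite -[X in measurable X]setTI; apply: emeasurable_fun_infty_c => //.
  exact/measurable_EFinP.
exists [set x | (f x)%:E <= 0]; split => //.
- rewrite (density_set fQ mA) integral0_eq// => x _.
  rewrite indicE; case: (boolP (x \in _)) => /= [|_]; last by rewrite mul0e.
  by rewrite inE /= lee_fin => fx; rewrite mul1e; congr EFin; apply/le_anti; rewrite fx f0.
- by move=> x /= /negP; rewrite -leNgt lee_fin.
Qed.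

Lemma integral_cst1 P : \int[P]_x cst 1 x = 1.
Proof. by rewrite integral_cst// mul1e; exact: probability_setT. Qed.

Lemma density_int1 P Q f : is_density P Q f -> \int[P]_x (f x)%:E = 1.
Proof.
move=> [mf f0 fQ].
have := fQ (cst 1) (measurable_cst _) (fun=> lee01).
rewrite integral_cst1 => ->.
by apply: eq_integral => x _; rewrite mul1e.
Qed.

Lemma measurable_inv f : measurable_fun [set: T] f -> (forall x, 0 <= f x)%R ->
  measurable_fun [set: T] (fun x => (f x)^-1)%R.
Proof.
move=> mf f0; rewrite (_ : (fun _ => _) = (fun x => f x `^ (-1))%R).
  exact: measurableT_comp (measurable_powR _) mf.
by apply/funext => x; rewrite powR_inv1.
Qed.

Lemma measurable_ratio X f : measurable_fun [set: T] X ->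
  measurable_fun [set: T] f -> (forall x, 0 <= f x)%R ->
  measurable_fun [set: T] (fun x => X x * ((f x)^-1)%:E).
Proof.
move=> mX mf f0; apply: emeasurable_funM => //; apply/measurable_EFinP.
exact: measurable_inv.
Qed.

(** The change of variables turns the ratio into [X x * ((f x)^-1 * f x)]; with
the convention [0^-1 = 0] the last product is 0 where [f] vanishes and 1
elsewhere, so only the [P]-mass of [X] where [f] vanishes is lost. *)
Lemma integral_ratio_le P Q f X : is_density P Q f ->
  measurable_fun [set: T] X -> (forall x, 0 <= X x) ->
  \int[Q]_x (X x * ((f x)^-1)%:E) <= \int[P]_x X x.
Proof.
move=> [mf f0 fQ] mX X0.
have mXf := measurable_ratio mX mf f0.
have Xf0 x : 0 <= X x * ((f x)^-1)%:E by rewrite mule_ge0// lee_fin invr_ge0.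
rewrite fQ//; apply: ge0_le_integral => //.
- by move=> x _; rewrite mule_ge0// lee_fin.
- by apply: emeasurable_funM => //; exact/measurable_EFinP.
- move=> x _; rewrite -muleA -EFinM -[leRHS]mule1 lee_wpmul2l// lee_fin.
  have [->|fx] := eqVneq (f x) 0%R; first by rewrite mulr0.
  by rewrite mulVf.
Qed.

Lemma integrable_inv_density P Q f : is_density P Q f ->
  Q.-integrable [set: T] (fun x => ((f x)^-1)%:E).
Proof.
move=> fQ; have [mf f0 _] := fQ.
apply: ge0_integrable => [|x|].
- by apply/measurable_EFinP; exact: measurable_inv.
- by rewrite lee_fin invr_ge0.
- apply: le_lt_trans (ltry 1); rewrite -(integral_cst1 P).
  have := integral_ratio_le fQ (measurable_cst 1) (fun=> lee01).
  by congr (_ <= _); apply: eq_integral => x _; rewrite mul1e.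
Qed.

(** The negative part of [ln f] is at most [f^-1], which has [Q]-integral at
most 1; so only the positive part can have an infinite integral. *)
Lemma integrable_ln_density P Q f : is_density P Q f ->
  \int[Q]_x (ln (f x))%:E < +oo ->
  Q.-integrable [set: T] (fun x => (ln (f x))%:E).
Proof.
move=> fQ lnfoo; have [mf f0 _] := fQ.
have mlnf : measurable_fun [set: T] (fun x => (ln (f x))%:E).
  by apply/measurable_EFinP; exact: measurableT_comp.
have fn : \int[Q]_x (fun x => (ln (f x))%:E)^\- x < +oo.
  have iV := integrable_inv_density fQ.
  have := integrable_fin_num measurableT iV; rewrite fin_numElt => /andP[_].
  apply: le_lt_trans; apply: ge0_le_integral => //.
  - exact: measurable_funeneg.
  - exact: measurable_int iV.
  - move=> x _; rewrite funenegE ge_max !lee_fin invr_ge0 f0 andbT.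
    have [fx|fx] := ltP 0%R (f x); last by rewrite ln0// oppr0 invr_ge0.
    rewrite -lnV//; apply: (le_trans (ln_le_sub1 _)); rewrite ?invr_gt0//.
    by rewrite gerBl.
apply: integrable_posneg => //.
have fnfin : \int[Q]_x (fun x => (ln (f x))%:E)^\- x \is a fin_num.
  by rewrite ge0_fin_numE// integral_ge0.
by rewrite integralE lteBlDr// addye// in lnfoo; rewrite gt_eqF// ltNye_eq fnfin.
Qed.

Lemma relative_entropyE P Q f : Q `<< P ->
  {ae P, forall x, (f x)%:E = ('d (charge_of_finite_measure Q) '/d P) x} ->
  is_density P Q f ->
  relative_entropy Q P = \int[Q]_x (ln (f x))%:E.
Proof.
move=> QP fE fQ; have [mf f0 _] := fQ.
rewrite /relative_entropy asboolT//.
apply: ae_eq_integral => //.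
- apply: measurableT_comp; first exact: measurable_lne.
  by [].
- by apply/measurable_EFinP; exact: measurableT_comp.
- have fEQ : ae_eq Q [set: T] (EFin \o f) ('d (charge_of_finite_measure Q) '/d P).
    by apply: (null_dominates_ae_eq measurableT QP); apply: filterS fE => x + _.
  apply: filterS2 fEQ (density_gt0 fQ) => x /(_ I) /= <- fx _.
  by rewrite lne_EFin.
Qed.

End densities.

(** * The Gibbs inequality and its equality case *)

Section gibbs.
Set Implicit Arguments.
Unset Strict Implicit.
Context (d : measure_display) (T : measurableType d) (R : realType).
Implicit Types (P Q : probability T R) (f : T -> R) (X : T -> \bar R).

Lemma tangent_integral P Q f X : is_density P Q f -> e_variable P X ->
  \int[Q]_x (ln (f x))%:E < +oo ->
  Q.-integrable [set: T] (fun x => (ln (f x))%:E + (X x * ((f x)^-1)%:E - 1))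
  /\ \int[Q]_x ((ln (f x))%:E + (X x * ((f x)^-1)%:E - 1)) <=
     \int[Q]_x (ln (f x))%:E.
Proof.
move=> fQ [mX X0 X1] lnfoo; have [mf f0 _] := fQ.
have ilnf := integrable_ln_density fQ lnfoo.
have ratio1 := le_trans (integral_ratio_le fQ mX X0) X1.
have iratio : Q.-integrable [set: T] (fun x => X x * ((f x)^-1)%:E).
  apply: ge0_integrable; first exact: measurable_ratio.
    by move=> x; rewrite mule_ge0// lee_fin invr_ge0.
  by rewrite (le_lt_trans ratio1)// ltry.
have i1 : Q.-integrable [set: T] (cst 1).
  by apply: ge0_integrable => //; rewrite integral_cst1 ltry.
have iratioB : Q.-integrable [set: T] (fun x => X x * ((f x)^-1)%:E - 1).
  exact: integrableB.
split; first exact: integrableD.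
rewrite integralD// -[leRHS]adde0 leeD2l// integralB// integral_cst1.
by rewrite leeBlDr// add0e.
Qed.

(** Integrate [lne_le_tangent] with respect to [Q]; the ratio term contributes
at most [1 - 1 = 0] because [X] is an e-variable for [P]. *)
Lemma gibbs P Q X : e_variable P X ->
  \int[Q]_x lne (X x) <= relative_entropy Q P.
Proof.
move=> eX; have [mX X0 _] := eX.
have [QP|QP] := pselect (Q `<< P); last first.
  by rewrite /relative_entropy asboolF// leey.
have [f fQ fE] := density_exists QP.
rewrite (relative_entropyE QP fE fQ).
have [->|] := eqVneq (\int[Q]_x (ln (f x))%:E) +oo; first exact: leey.
rewrite -ltey => lnfoo.
have [itan letan] := tangent_integral fQ eX lnfoo.
apply: le_trans letan; apply: le_integral_ae.
- by apply: measurableT_comp => //; exact: measurable_lne.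
- exact: measurable_int itan.
- by apply: filterS (density_gt0 fQ) => x fx; exact: lne_le_tangent.
Qed.

(** Equality of the integrals forces equality in the tangent bound, so [X = f]
holds [Q]-almost surely.  Hence [f <= X] holds [P]-almost surely, and as [f]
has [P]-integral 1 while [X] has [P]-integral at most 1, the two agree. *)
Lemma gibbs_eq P Q f X : is_density P Q f -> e_variable P X ->
  \int[Q]_x (ln (f x))%:E < +oo ->
  \int[Q]_x (ln (f x))%:E <= \int[Q]_x lne (X x) ->
  {ae P, forall x, X x = (f x)%:E}.
Proof.
move=> fQ eX lnfoo lnfX; have [mX X0 X1] := eX; have [mf f0 _] := fQ.
have [itan letan] := tangent_integral fQ eX lnfoo.
have iX : P.-integrable [set: T] X.
  by apply: ge0_integrable => //; rewrite (le_lt_trans X1)// ltry.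
have XfQ : {ae Q, forall x, X x = (f x)%:E}.
  have mlneX : measurable_fun [set: T] (fun x => lne (X x)).
    by apply: measurableT_comp => //; exact: measurable_lne.
  have lnetan : {ae Q, forall x,
      lne (X x) <= (ln (f x))%:E + (X x * ((f x)^-1)%:E - 1)}.
    by apply: filterS (density_gt0 fQ) => x fx; exact: lne_le_tangent.
  have := le_integral_ae_eq mlneX itan lnetan (le_trans letan lnfX).
  apply: filterS3 (density_gt0 fQ) (integrable_ae measurableT itan) => x fx /(_ I) tfin.
  apply: lne_eq_tangent => //; rewrite ltey; apply/eqP => Xoo; move: tfin.
  by rewrite Xoo gt0_mulye// lte_fin invr_gt0.
have mA : measurable [set x | X x < (f x)%:E].
  rewrite -[X in measurable X]setTI; apply: measurable_lte => //.
  exact/measurable_EFinP.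
have QA0 : Q [set x | X x < (f x)%:E] = 0.
  apply: measure_negligible => //; apply: negligibleS XfQ => x /=.
  by move=> Xf XfE; move: Xf; rewrite XfE ltxx.
have fX : {ae P, forall x, (f x)%:E <= X x}.
  apply: filterS (density_null fQ mA QA0) => x; rewrite leNgt => Af.
  by apply/negP => XfA; move: (XfA); rewrite (Af XfA) ltNge X0.
have mEf : measurable_fun [set: T] (EFin \o f) by exact/measurable_EFinP.
have := le_integral_ae_eq mEf iX fX; rewrite /= (density_int1 fQ) => /(_ X1).
by apply: filterS.
Qed.

Lemma relative_entropy_ge0 P Q : 0 <= relative_entropy Q P.
Proof.
have e1 : e_variable P (fun=> 1).
  by split => //; rewrite (integral_cst1 P).
apply: le_trans (gibbs Q e1); rewrite integral0_eq// => x _.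
exact: lne1.
Qed.

End gibbs.

(** * Entropy controls bounded test functions *)

Section bounded_tests.
Set Implicit Arguments.
Unset Strict Implicit.
Context (d : measure_display) (T : measurableType d) (R : realType).
Implicit Types (P Q G : probability T R) (l u : T -> R).

Lemma bounded_integrable Q l (C : R) : measurable_fun [set: T] l ->
  (forall x, `|l x| <= C)%R -> Q.-integrable [set: T] (EFin \o l).
Proof.
move=> ml lC; apply: measurable_bounded_integrable => //.
  by rewrite -ge0_fin_numE//; exact: fin_num_measure.
by exists C; split; [exact: num_real|move=> r Cr x _; exact: le_trans (lC x) (ltW Cr)].
Qed.

Lemma Rintegral_cst1 Q (r : R) : (\int[Q]_x r = r)%R.
Proof.
rewrite Rintegral_cst// [X in fine X](_ : _ = 1) ?mulr1//.
exact: probability_setT.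
Qed.

(** The e-variable [1 + v] of [G], with [v = delta (E_G[l] - l)], has expected
logarithm at most [eta] under [Q]; since [v >= - 1/2], this logarithm is
at least [v - 2 v^2 >= v - 8 delta^2 C^2]. *)
Lemma bounded_test_near Q G l (C delta eta : R) :
  measurable_fun [set: T] l -> (forall x, `|l x| <= C)%R ->
  (0 < delta)%R -> (4 * C * delta <= 1)%R ->
  relative_entropy Q G <= eta%:E ->
  (\int[G]_x l x <= \int[Q]_x l x + eta / delta + 8 * delta * C ^+ 2)%R.
Proof.
move=> ml lC d0 Cd1 QG.
set m := (\int[G]_x l x)%R.
have il Q' : Q'.-integrable [set: T] (EFin \o l) by exact: bounded_integrable lC.
have icst (Q' : probability T R) (r : R) : Q'.-integrable [set: T] (EFin \o (fun=> r)).
  exact: (@bounded_integrable _ _ `|r|%R).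
have mC : (`|m| <= C)%R.
  rewrite ler_norml; apply/andP; split.
    rewrite -[leLHS](Rintegral_cst1 G).
    apply: (le_Rintegral measurableT (icst _ _) (il _)) => x _ /=.
    by have := lC x; rewrite ler_norml => /andP[].
  rewrite -[leRHS](Rintegral_cst1 G).
  apply: (le_Rintegral measurableT (il _) (icst _ _)) => x _ /=.
  by have := lC x; rewrite ler_norml => /andP[].
pose v x := (delta * (m - l x))%R.
have v_small x : (`|v x| <= 2 * C * delta)%R.
  rewrite normrM gtr0_norm// mulrC ler_wpM2r ?(ltW d0)//.
  by rewrite (le_trans (ler_normB _ _))//; have := lC x; lra.
have v_ge x : (- 2^-1 <= v x)%R.
  by have := v_small x; rewrite ler_norml => /andP[]; lra.
have mv : measurable_fun [set: T] v.
  by apply: measurable_funM => //; apply: measurable_funB.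
have iv Q' : Q'.-integrable [set: T] (EFin \o v) by exact: bounded_integrable v_small.
have intv Q' : (\int[Q']_x v x = delta * (m - \int[Q']_x l x))%R.
  rewrite RintegralZl//; last exact: (integrableB measurableT (icst Q' m) (il Q')).
  by rewrite (RintegralB measurableT (icst Q' m) (il Q')) Rintegral_cst1.
have eY : e_variable G (fun x => (1 + v x)%:E).
  split.
  - by apply/measurable_EFinP; exact: measurable_funD.
  - by move=> x; rewrite lee_fin; have := v_ge x; lra.
  - rewrite -[leLHS]fineK; last first.
      apply: integrable_fin_num => //.
      exact: (integrableD measurableT (icst G 1%R) (iv G)).
    rewrite lee_fin -/(Rintegral _ _ _) (RintegralD measurableT (icst G 1%R) (iv G)).
    by rewrite Rintegral_cst1 intv subrr mulr0 addr0.
have := le_trans (gibbs Q eY) QG.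
have quad : {ae Q, forall x, (v x - 8 * delta ^+ 2 * C ^+ 2)%:E <= lne (1 + v x)%:E}.
  apply: aeW => x; rewrite lne_EFin; last by have := v_ge x; lra.
  rewrite lee_fin; apply: le_trans (ln_ge_quadratic (v_ge x)).
  rewrite lerD2l lerN2 -[(v x ^+ 2)%R]real_normK ?num_real//.
  have := v_small x; have := normr_ge0 (v x); rewrite !expr2; nra.
have mlne : measurable_fun [set: T] (fun x => lne (1 + v x)%:E).
  apply: measurableT_comp; first exact: measurable_lne.
  by case: eY.
have mq : measurable_fun [set: T] (fun x => (v x - 8 * delta ^+ 2 * C ^+ 2)%:E).
  by apply/measurable_EFinP; apply: measurable_funB.
move=> /(le_trans (le_integral_ae mq mlne quad)).
rewrite -[X in X <= _]fineK; last first.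
  apply: integrable_fin_num => //.
  exact: (integrableB measurableT (iv Q) (icst Q _)).
rewrite lee_fin -/(Rintegral _ _ _) (RintegralB measurableT (iv Q) (icst Q _)).
rewrite Rintegral_cst1 intv => H.
rewrite -(ler_pM2l d0) !mulrDr (mulrCA delta eta) mulfV ?gt_eqF//.
by rewrite !expr2 in H *; nra.
Qed.

(** A measure [Q] of [Qs] with [H(Q|P) < c + delta^2] has
[H(Q|G) <= delta^2], so replacing [G] by [Q] in the integral of [ln u] costs at
most [delta + 8 delta C^2], and the Gibbs inequality bounds the integral under
[Q] by [c + delta^2]. *)
Lemma bounded_log_le_inf_entropy P (Qs : set (probability T R)) G (c a b : R) u :
  is_generalized_I_projection P Qs G -> inf_entropy P Qs = c%:E ->
  measurable_fun [set: T] u -> (0 < a)%R -> (forall x, a <= u x <= b)%R ->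
  \int[P]_x (u x)%:E <= 1 -> (\int[G]_x ln (u x) <= c)%R.
Proof.
move=> GIPr infE mu a0 uab u1.
have u0 x : (0 < u x)%R by have /andP[/(lt_le_trans a0)] := uab x.
have eu : e_variable P (EFin \o u).
  by split => // [|x]; [exact/measurable_EFinP|rewrite lee_fin ltW].
(* With [1 <= C], the error terms [delta] and [delta^2] below are at most
   [delta C^2]. *)
pose C := (1 + (`|ln a| + `|ln b|))%R.
have C1 : (1 <= C)%R by rewrite /C lerDl addr_ge0.
have mlnu : measurable_fun [set: T] (fun x => ln (u x)).
  exact: measurableT_comp.
have lnuC x : (`|ln (u x)| <= C)%R.
  by rewrite (le_trans (normr_ln_le a0 (uab x)))// /C lerDr.
apply/ler_addgt0Pr => e e0.
(* The first bound is the one required by [bounded_test_near]; the second one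
   makes the total error [delta^2 + delta + 8 delta C^2] at most [e]. *)
pose delta := Num.min (4 * C)^-1%R (e / (10 * C ^+ 2))%R.
have C0 : (0 < C)%R by lra.
have d0 : (0 < delta)%R.
  by rewrite lt_min invr_gt0 divr_gt0 ?mulr_gt0 ?exprn_gt0.
have d1 : (4 * C * delta <= 1)%R.
  rewrite -[leRHS](@mulfV _ (4 * C)%R) ?gt_eqF ?mulr_gt0// ler_wpM2l ?ge_min ?lexx//.
  by rewrite mulr_ge0// ltW.
have de : (10 * C ^+ 2 * delta <= e)%R.
  have C2 : (0 < 10 * C ^+ 2)%R by rewrite mulr_gt0 ?exprn_gt0.
  by rewrite mulrC -ler_pdivlMr// ge_min lexx orbT.
have [] := @lb_ereal_inf_adherent _ [set relative_entropy Q P | Q in Qs] (delta ^+ 2)%R.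
- by rewrite exprn_gt0.
- by rewrite -/(inf_entropy P Qs) infE.
move=> _ [Q QQs <-]; rewrite -/(inf_entropy P Qs) infE -EFinD => QP.
have QG : relative_entropy Q G <= (delta ^+ 2)%:E.
  have := le_lt_trans (GIPr Q QQs) QP; rewrite infE => /ltW.
  by rewrite (addrC c) EFinD leeD2rE.
have := bounded_test_near mlnu lnuC d0 d1 QG.
have : (\int[Q]_x ln (u x) <= c + delta ^+ 2)%R.
  have := le_trans (gibbs Q eu) (ltW QP); rewrite -lee_fin /Rintegral fineK.
    congr (_ <= _); apply: eq_integral => x _; exact: lne_EFin.
  apply: integrable_fin_num => //; exact: bounded_integrable lnuC.
rewrite expr2 mulfK ?gt_eqF// => H1 H2.
have : (delta <= 1)%R by nra.
rewrite expr2 in de H2; move=> ?.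
have : (delta * delta <= delta * (C * C))%R by rewrite ler_wpM2l ?(ltW d0)//; nra.
have : (delta <= delta * (C * C))%R by rewrite -[leLHS]mulr1 ler_wpM2l ?(ltW d0)//; nra.
by nra.
Qed.

End bounded_tests.

(** * Truncated densities *)

Section truncation.
Set Implicit Arguments.
Unset Strict Implicit.
Variable R : realType.
Implicit Types f : R.

(** The values of a density are clipped to [[1/(n+1), n+1]]; clipping from
below raises the integral by at most [1/(n+1)], and the denominator brings it
back to at most 1. *)
Definition truncation n f : R :=
  (Num.max n.+1%:R^-1 (Num.min n.+1%:R f) / (1 + n.+1%:R^-1))%R.

Lemma truncation_bounds n f :
  (n.+1%:R^-1 / 2 <= truncation n f <= n.+1%:R)%R.
Proof.
have n1 : (1 <= n.+1%:R :> R)%R by rewrite ler1n.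
have V1 : (n.+1%:R^-1 <= 1 :> R)%R by rewrite invf_le1 ?ler1n.
have V0 : (0 < n.+1%:R^-1 :> R)%R by rewrite invr_gt0.
rewrite /truncation; set V := n.+1%:R^-1%R in V0 V1 *; apply/andP; split.
  apply: ler_pM; rewrite ?invr_ge0//.
    by rewrite le_max lexx.
  by rewrite lef_pV2 ?posrE; lra.
rewrite ler_pdivrMr; last lra.
rewrite (@le_trans _ _ n.+1%:R%R)//; last by rewrite ler_peMr//; lra.
by rewrite ge_max (le_trans V1)//= ge_min lexx.
Qed.

Lemma truncation_le n f : (0 <= f)%R ->
  (truncation n f <= (n.+1%:R^-1 + f) / (1 + n.+1%:R^-1))%R.
Proof.
move=> f0; have V0 : (0 < n.+1%:R^-1 :> R)%R by rewrite invr_gt0.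
rewrite /truncation; set V := n.+1%:R^-1%R in V0 *.
rewrite ler_pM2r ?invr_gt0; last lra.
by rewrite ge_max lerDl f0/= ge_min lerDr (ltW V0) orbT.
Qed.

(** This lower bound does not depend on [n], and [f^-1] is integrable against
the measure of density [f]: it is what Fatou's lemma needs. *)
Lemma ln_truncation_ge n f : (0 < f)%R ->
  (0 <= ln (truncation n f) + (1 + 2 * f^-1))%R.
Proof.
move=> f0; have n1 : (1 <= n.+1%:R :> R)%R by rewrite ler1n.
have V1 : (n.+1%:R^-1 <= 1 :> R)%R by rewrite invf_le1 ?ler1n.
have V0 : (0 < n.+1%:R^-1 :> R)%R by rewrite invr_gt0.
set u := truncation n f.
have u0 : (0 < u)%R.
  by have /andP[+ _] := truncation_bounds n f; apply: lt_le_trans; rewrite divr_gt0.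
have Vu0 : (0 < u^-1)%R by rewrite invr_gt0.
have := ln_le_sub1 Vu0; rewrite lnV ?posrE//.
suff : (u^-1 <= 2 * (1 + f^-1))%R by lra.
have m0 : (0 < Num.min n.+1%:R f)%R by rewrite lt_min f0 andbT; lra.
have mu : (Num.min n.+1%:R f / 2 <= u)%R.
  apply: ler_pM; rewrite ?invr_ge0 ?(ltW m0)//.
    by rewrite le_max lexx orbT.
  by rewrite lef_pV2 ?posrE ?addr_gt0// -[leRHS]/(1 + 1)%R lerD2l.
have : (u^-1 <= (Num.min n.+1%:R f / 2)^-1)%R.
  by rewrite lef_pV2 ?posrE // divr_gt0.
move=> /le_trans; apply; rewrite invfM invrK mulrC ler_wpM2l//.
have Vf0 : (0 < f^-1)%R by rewrite invr_gt0.
rewrite /Num.min; case: ifP => _; first by rewrite (le_trans V1)// lerDl ltW.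
by rewrite lerDr.
Qed.

Lemma ln_truncation_cvg f : (0 < f)%R ->
  (ln (truncation n f) @[n --> \oo] --> ln f)%R.
Proof.
move=> f0; apply: continuous_cvg; first exact: continuous_ln.
have eqf : \forall n \near \oo, (f / (1 + @harmonic R n) = truncation n f)%R.
  near=> n; rewrite /truncation /harmonic /=; congr (_ / _)%R.
  have nf : (f <= n.+1%:R)%R.
    by apply: (@le_trans _ _ n%:R%R); [near: n; exact: nbhs_infty_ger|rewrite ler_nat].
  have nVf : (f^-1 <= n.+1%:R)%R.
    by apply: (@le_trans _ _ n%:R%R); [near: n; exact: nbhs_infty_ger|rewrite ler_nat].
  rewrite (min_idPr nf); apply/esym/max_idPr.
  by rewrite -[leRHS]invrK lef_pV2 ?posrE ?invr_gt0.
apply: cvg_trans (near_eq_cvg eqf) _.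
have : (f / (1 + @harmonic R n) @[n --> \oo] --> f / (1 + 0))%R.
  apply: cvgM; first exact: cvg_cst.
  apply: cvgV; first by rewrite addr0.
  by apply: cvgD; [exact: cvg_cst|exact: cvg_harmonic].
by rewrite addr0 divr1.
Unshelve. all: by end_near.
Qed.

End truncation.

(** * The entropy of the generalized projection *)

Section projection_entropy.
Set Implicit Arguments.
Unset Strict Implicit.
Context (d : measure_display) (T : measurableType d) (R : realType).
Implicit Types (P G : probability T R) (f : T -> R).

Lemma measurable_truncation n f : measurable_fun [set: T] f ->
  measurable_fun [set: T] (fun x => truncation n (f x)).
Proof.
move=> mf; apply: measurable_funM => //; apply: measurable_maxr => //.
exact: measurable_minr.
Qed.

Lemma integral_truncation_le1 P G f n : is_density P G f ->
  \int[P]_x (truncation n (f x))%:E <= 1.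
Proof.
move=> fG; have [mf f0 _] := fG.
have V0 : (0 < n.+1%:R^-1 :> R)%R by rewrite invr_gt0.
set V := n.+1%:R^-1%R in V0.
have mt := measurable_truncation n mf.
have W0 : (0 <= (1 + V)^-1)%R by rewrite invr_ge0; lra.
have : \int[P]_x (truncation n (f x))%:E <= \int[P]_x ((1 + V)^-1%:E * (V + f x)%:E).
  apply: ge0_le_integral => //.
  - move=> x _; rewrite lee_fin; have /andP[+ _] := truncation_bounds n (f x).
    by apply: le_trans; rewrite divr_ge0// invr_ge0.
  - exact/measurable_EFinP.
  - by apply/measurable_EFinP; apply: measurable_funM => //; exact: measurable_funD.
  - by move=> x _; rewrite -EFinM lee_fin mulrC; exact: truncation_le.
move=> /le_trans; apply.
rewrite ge0_integralZl//; last 2 first.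
- by apply/measurable_EFinP; exact: measurable_funD.
- by move=> x _; rewrite lee_fin addr_ge0// ltW.
under eq_integral do rewrite EFinD.
rewrite ge0_integralD//; last 3 first.
- by move=> x _; rewrite lee_fin ltW.
- by move=> x _; rewrite lee_fin.
- exact/measurable_EFinP.
rewrite integral_cst// [X in V%:E * X]probability_setT mule1 (density_int1 fG).
by rewrite -EFinD -EFinM (addrC V) mulVf// gt_eqF//; lra.
Qed.

(** Truncated densities are bounded e-variables of [P], so their expected
logarithms under [G] are at most [c]; Fatou's lemma applies after adding the
integrable function [K], which makes them nonnegative [G]-almost everywhere. *)
Lemma ln_density_le_inf_entropy P (Qs : set (probability T R)) G (c : R) f :
  is_generalized_I_projection P Qs G -> inf_entropy P Qs = c%:E ->
  is_density P G f -> \int[G]_x (ln (f x))%:E <= c%:E.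
Proof.
move=> GIPr infE fG; have [mf f0 _] := fG.
pose K x := (1 + 2 * (f x)^-1)%R.
have mV : measurable_fun [set: T] (fun x => (f x)^-1)%R by exact: measurable_inv.
have mK : measurable_fun [set: T] K.
  by apply: measurable_funD => //; exact: measurable_funM.
have iK : G.-integrable [set: T] (EFin \o K).
  have i1 : G.-integrable [set: T] (EFin \o fun=> 1%R).
    by apply: (@bounded_integrable _ _ _ _ _ 1%R) => // x; rewrite normr1.
  have iV := integrableZl measurableT 2%R (integrable_inv_density fG).
  exact: (integrableD measurableT i1 iV).
have mt n := measurable_truncation n mf.
have mlnt n : measurable_fun [set: T] (fun x => ln (truncation n (f x))).
  exact: measurableT_comp.
(* Where [f] vanishes, a [G]-null set, [h n] can be negative; Fatou's lemma is
   therefore applied to the positive parts. *)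
pose h n x := (ln (truncation n (f x)) + K x)%:E.
have mh n : measurable_fun [set: T] (h n).
  by apply/measurable_EFinP; exact: measurable_funD.
have mph n : measurable_fun [set: T] (h n)^\+ by exact: measurable_funepos.
pose b := c%:E + \int[G]_x (K x)%:E.
have h0 n : {ae G, forall x, 0 <= h n x}.
  by apply: filterS (density_gt0 fG) => x fx; rewrite lee_fin ln_truncation_ge.
have int_ph n : \int[G]_x (h n)^\+ x <= b.
  rewrite (ae_eq_integral (h n))//; last first.
    by apply: filterS (h0 n) => x hx _; rewrite funeposE max_l.
  have V0 : (0 < n.+1%:R^-1 / 2 :> R)%R by rewrite divr_gt0.
  have ilnt : G.-integrable [set: T] (EFin \o (fun x => ln (truncation n (f x)))).
    apply: bounded_integrable (mlnt n) _ => x.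
    exact: (normr_ln_le V0 (truncation_bounds n (f x))).
  rewrite (integralD_EFin measurableT ilnt iK) leeD2r// -[leLHS]fineK.
    rewrite lee_fin -/(Rintegral _ _ _).
    apply: (bounded_log_le_inf_entropy GIPr infE (mt n) V0 _
      (integral_truncation_le1 n fG)) => x.
    exact: truncation_bounds.
  exact: integrable_fin_num.
have mlim : measurable_fun [set: T] (fun x => limn_einf (fun n => (h n)^\+ x)).
  have -> : (fun x => limn_einf (fun n => (h n)^\+ x)) =
            (fun x => - limn_esup (fun n => - (h n)^\+ x)).
    apply/funext => x; rewrite -[RHS]limn_einfN; congr limn_einf.
    by apply/funext => n /=; rewrite oppeK.
  apply: measurableT_comp => //; apply: measurable_fun_limn_esup => n.
  exact: measurableT_comp.
pose g x := (ln (f x) + K x)%:E.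
have mg : measurable_fun [set: T] g.
  by apply/measurable_EFinP; apply: measurable_funD => //; exact: measurableT_comp.
have g0 : {ae G, forall x, 0 <= g x}.
  apply: filterS (density_gt0 fG) => x fx; rewrite lee_fin.
  have Vfx : (0 < (f x)^-1)%R by rewrite invr_gt0.
  by have := ln_le_sub1 Vfx; rewrite lnV ?posrE// /K; lra.
have int_g : \int[G]_x g x <= b.
  apply: (@le_trans _ _ (\int[G]_x limn_einf (fun n => (h n)^\+ x))).
    apply: le_integral_ae => //; apply: filterS (density_gt0 fG) => x fx.
    have hx : (fun n => (h n)^\+ x) = (fun n => h n x).
      apply/funext => n; rewrite funeposE max_l// lee_fin.
      exact: ln_truncation_ge.
    rewrite hx.
    have hg : h n x @[n --> \oo] --> g x.
      apply: cvg_EFin; first exact: nearW.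
      by apply: cvgD; [exact: ln_truncation_cvg|exact: cvg_cst].
    by rewrite (cvg_limn_einf_sup hg).1.
  apply: le_trans (fatou _ _ _ _) _ => //.
  exact: limn_einf_le.
have ig : G.-integrable [set: T] g.
  apply: fin_num_integrable => //; rewrite ge0_fin_numE.
    apply: (le_lt_trans int_g); rewrite /b lte_add_pinfty ?ltry// ltey_eq.
    by rewrite (integrable_fin_num measurableT iK).
  rewrite -(integral0 G [set: T]); exact: le_integral_ae.
have -> : \int[G]_x (ln (f x))%:E = \int[G]_x (g x - (K x)%:E).
  by apply: eq_integral => x _; rewrite /g EFinD addeK.
rewrite integralB// leeBlDr//; exact: integrable_fin_num.
Qed.

End projection_entropy.

Theorem theorem4p2 (d : measure_display) (T : measurableType d) (R : realType)
    (P : probability T R) (Qs : set (probability T R))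
    (Qs_nonempty : Qs !=set0)
    (Qs_convex : convex_probabilities Qs)
    (inf_entropy_finite : inf_entropy P Qs < +oo)
    (Qg : probability T R) (Qg_proj : is_generalized_I_projection P Qs Qg)
    (Xs : T -> \bar R) (Xs_version : is_density_version P Qg Xs)
    (Xs_log : forall Q, Qs Q -> inf_entropy P Qs <= expected_log Q Xs) :
  [/\ is_GROW P Qs Xs,
      grow_value P Qs = inf_expected_log Qs Xs,
      inf_expected_log Qs Xs = inf_entropy P Qs &
      Qs Qg ->
        is_GROW P Qs Xs /\
        forall X : T -> \bar R, is_GROW P Qs X -> {ae P, forall x, X x = Xs x}].
Proof.
have [mXs Xs0 XsE] := Xs_version.
(* Without absolute continuity, the Radon-Nikodym derivative is the constant
   [-oo], which has no nonnegative version. *)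
have QgP : Qg `<< P.
  apply: contrapT => nQgP.
  have : P.-negligible [set: T].
    apply: negligibleS XsE => x _ /=; move: (Xs0 x).
    rewrite /Radon_Nikodym; case: pselect => //= _ + XsNy.
    by rewrite XsNy.
  move=> /(measure_negligible measurableT) /eqP.
  by rewrite [X in X == _]probability_setT onee_eq0.
have [f fQg fE] := density_exists QgP.
have Xsf : {ae P, forall x, Xs x = (f x)%:E}.
  by apply: filterS2 XsE fE => x -> ->.
have [mf f0 _] := fQg.
have eXs : e_variable P Xs.
  split => //; rewrite (ae_eq_integral (EFin \o f))//.
  - by rewrite (density_int1 fQg).
  - exact/measurable_EFinP.
  - by apply: filterS Xsf => x + _.
have weak_duality X : e_variable P X -> inf_expected_log Qs X <= inf_entropy P Qs.
  move=> eX; apply: le_ereal_inf_tmp => _ [Q QQs <-].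
  apply: (@le_trans _ _ (expected_log Q X)).
    by apply: ereal_inf_lbound; exists Q.
  by rewrite expected_logE; exact: gibbs.
have XsE_inf : inf_expected_log Qs Xs = inf_entropy P Qs.
  apply/eqP; rewrite eq_le weak_duality//=.
  by apply: le_ereal_inf_tmp => _ [Q QQs <-]; exact: Xs_log.
have growE : grow_value P Qs = inf_entropy P Qs.
  apply/eqP; rewrite eq_le; apply/andP; split.
    by apply: ge_ereal_sup => _ [X eX <-]; exact: weak_duality.
  by rewrite -XsE_inf; apply: ereal_sup_ubound; exists Xs.
have grow_Xs : is_GROW P Qs Xs by split; rewrite // XsE_inf growE.
split => //; first by rewrite growE XsE_inf.
move=> QsQg; split => // X [eX XE].
have inf_fin : inf_entropy P Qs \is a fin_num.
  rewrite ge0_fin_numE//; apply: le_ereal_inf_tmp => _ [Q _ <-].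
  exact: relative_entropy_ge0.
have infE : inf_entropy P Qs = (fine (inf_entropy P Qs))%:E by rewrite fineK.
have lnf := ln_density_le_inf_entropy Qg_proj infE fQg.
have : {ae P, forall x, X x = (f x)%:E}.
  apply: (gibbs_eq fQg eX); first by rewrite (le_lt_trans lnf)// ltry.
  rewrite (le_trans lnf)// -infE -growE -XE -expected_logE.
  by apply: ereal_inf_lbound; exists Qg.
by move=> Xf; apply: filterS2 Xf Xsf => x -> ->.
Qed.
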